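(* Let $T$ be a finite tree with at least two vertices, let $v_n$ be a leaf of $T$, and let $v_{n-1}$ be the unique neighbour of $v_n$. For each edge $e\in E(T)$ let a density $\gamma_e=1-r_e\in[0,1]$ be given, and write $r_{n-1,n}$ for the value of $r_e$ at the edge $e=v_{n-1}v_n$; assume $r_{n-1,n}<1$. Let $T'=T-v_n$ be the tree obtained by deleting the leaf $v_n$ (together with the edge $v_{n-1}v_n$), and for $e\in E(T')$ define $$\gamma'_e=\begin{cases}\gamma_e=1-r_e & \text{if } e \text{ is not incident to } v_{n-1},\\[2pt] 1-\dfrac{r_e}{1-r_{n-1,n}} & \text{if } e \text{ is incident to } v_{n-1}.\end{cases}$$ Then the densities $(\gamma_e)_{e\in E(T)}$ ensure the existence of the factor $T$ if and only if all the numbers $\gamma'_e$ ($e\in E(T')$) lie between $0$ and $1$ and the densities $(\gamma'_e)_{e\in E(T')}$ ensure the existence of the factor $T'$.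
   Context: All graphs are finite and simple. A weighted blow-up graph $G[H]$ of a graph $H$ is a graph whose vertex set is the disjoint union of finite nonempty clusters $A_v$ ($v\in V(H)$), whose edges only join vertices of $A_u$ to vertices of $A_v$ with $uv\in E(H)$ (not necessarily all such pairs), together with non-negative vertex weights $w$ such that the total weight of each cluster is $1$. For $uv\in E(H)$ the density is $d(A_u,A_v)=\sum w(x)w(y)$, the sum running over all edges $xy$ of $G[H]$ with $x\in A_u$, $y\in A_v$. $G[H]$ contains $H$ as a transversal (equivalently, as a factor) if one can choose a vertex $\varphi(v)\in A_v$ for every $v\in V(H)$ such that $\varphi(u)\varphi(v)\in E(G[H])$ for every $uv\in E(H)$. Numbers $(\gamma_e)_{e\in E(H)}$ ensure the existence of the factor $H$ if every weighted blow-up graph of $H$ with $d(A_u,A_v)\ge\gamma_{uv}$ for all $uv\in E(H)$ contains $H$ as a transversal. *)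

(* Defs.v *)
From HB Require Import structures.
From mathcomp Require Import all_boot all_order all_algebra reals.

Set Implicit Arguments.
Unset Strict Implicit.
Unset Printing Implicit Defensive.

Import Order.TTheory GRing.Theory Num.Theory.
Local Open Scope ring_scope.

Record sgraph := SGraph {
  svertex :> finType;
  sedge : rel svertex;
  sedge_sym : symmetric sedge;
  sedge_irrefl : irreflexive sedge }.

Notation "x -- y" := (sedge x y) (at level 30).

Section Graph.
Variable G : sgraph.

Definition neighbours (v : G) : {set G} := [set u | v -- u].

Definition edges : {set {set G}} :=
  [set e | [exists x : G, exists y : G, (x -- y) && (e == [set x; y])]].

(* Connected and acyclic; the bound on the size excludes the closed walk
   x, y, x along a single edge, which [cycle] accepts. *)
Definition is_tree : Prop :=
  [/\ (0 < #|G|)%N,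
      forall x y : G, connect (@sedge G) x y &
      forall c : seq G, (2 < size c)%N -> uniq c -> ~~ cycle (@sedge G) c].

Definition is_leaf (v : G) : bool := #|neighbours v| == 1%N.

Variable v : G.

Definition del_edge : rel {x : G | x != v} := fun x y => val x -- val y.

Fact del_edge_sym : symmetric del_edge.
Proof. by move=> x y; apply: sedge_sym. Qed.

Fact del_edge_irrefl : irreflexive del_edge.
Proof. by move=> x; apply: sedge_irrefl. Qed.

Definition del_vertex : sgraph := SGraph del_edge_sym del_edge_irrefl.

End Graph.

Record weighted_blowup (R : realType) (H : sgraph) := WeightedBlowup {
  blowup_graph :> sgraph;
  proj : blowup_graph -> H;
  weight : blowup_graph -> R;
  proj_edge : forall x y : blowup_graph, x -- y -> proj x -- proj y;
  proj_surj : forall v : H, exists x : blowup_graph, proj x = v;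
  weight_ge0 : forall x : blowup_graph, 0 <= weight x;
  weight_cluster : forall v : H, \sum_(x | proj x == v) weight x = 1 }.

Section Blowup.
Variables (R : realType) (H : sgraph).

Definition cluster (B : weighted_blowup R H) (v : H) : {set B} :=
  [set x | proj x == v].

Definition density (B : weighted_blowup R H) (u v : H) : R :=
  \sum_(x in cluster B u) \sum_(y in cluster B v | x -- y) weight x * weight y.

Definition has_transversal (B : weighted_blowup R H) : Prop :=
  exists phi : H -> B,
    (forall v, phi v \in cluster B v) /\
    (forall u v, u -- v -> phi u -- phi v).

(* Only the values of gamma on the edges of H matter. *)
Definition ensures_factor (gamma : {set H} -> R) : Prop :=
  forall B : weighted_blowup R H,
    (forall u v : H, u -- v -> gamma [set u; v] <= density B u v) ->
    has_transversal B.

End Blowup.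

(* The edge e of T - l is viewed as the edge [val @: e] of T. *)
Definition reduced_density (R : realType) (T : sgraph) (l p : T)
    (r : {set T} -> R) (e : {set del_vertex l}) : R :=
  let e0 : {set T} := [set val x | x in e] in
  if p \in e0 then 1 - r e0 / (1 - r [set p; l]) else 1 - r e0.

(* Main.v *)
Require Import Defs.
From HB Require Import structures.
From mathcomp Require Import all_boot all_order all_algebra reals.

Set Implicit Arguments.
Unset Strict Implicit.
Unset Printing Implicit Defensive.

Import Order.TTheory GRing.Theory Num.Theory.
Local Open Scope ring_scope.

(** Write the density along an edge as one minus the missing density, the total
weight of the non-adjacent pairs; the condition [1 - r e <= density] then says
that at most [r e] is missing. Let [l] be the leaf, [p] its neighbour, and
[a = 1 - r_pl > 0]. In a blow-up of [T] only the vertices of the cluster of [p]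
that have a neighbour in the cluster of [l] can be used by a transversal, and
any transversal of [T - l] using such a vertex extends to [l]. Since density at
least [a] along [pl] forces these vertices to weigh at least [a], the two
problems correspond as follows ([density_le_served] gives this bound).

If the reduced densities ensure [T - l], keep only the useful vertices of the
cluster of [p], and divide their weights by their total. A missing density can
only decrease by deletion, and is then multiplied along the edges at [p] by at
most [1 / a], which is exactly what the reduced densities tolerate
([missing_prune], [prune_transversal]).

Conversely, a blow-up of [T - l] is turned into one of [T]: the weights over [p]
are multiplied by [a], a decoy vertex of weight [1 - a] is added over [p] and
joined to all of the old clusters of the neighbours of [p], and the new cluster of [l] is one
vertex joined to all the old vertices over [p]. The decoy misses nothing towards
the old clusters and misses exactly [1 - a] towards the leaf
([missing_extend], [missing_extend_leaf]), while no transversal can use it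
([extend_transversal]).

Positivity of the reduced densities then comes for free: if densities at most
[1] ensure the factor [H], none of them is [<= 0], because [H] itself with one
edge cut is a blow-up without a transversal ([ensures_factor_gt0]). *)

(** * Sums over an optional type and missing density *)

Lemma sum_option (V : nmodType) (I : finType) (P : pred (option I))
    (F : option I -> V) :
  \sum_(x | P x) F x =
  (if P None then F None else 0) + \sum_(x | P (Some x)) F (Some x).
Proof.
rewrite big_mkcond (bigD1 None) //=; congr (_ + _).
rewrite (reindex_omap Some id) => [|[]] //=.
by rewrite [RHS]big_mkcond; apply: eq_bigl => x; rewrite eqxx.
Qed.

Section MissingDensity.
Variables (R : realType) (H : sgraph).

Definition missing (B : weighted_blowup R H) (u v : H) : R :=
  \sum_(x in cluster B u) \sum_(y in cluster B v | ~~ (x -- y))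
    weight x * weight y.

Lemma sum_cluster (B : weighted_blowup R H) (v : H) :
  \sum_(x in cluster B v) weight x = 1.
Proof.
by rewrite -[RHS](weight_cluster B v); apply: eq_bigl => x; rewrite inE.
Qed.

Lemma densityE (B : weighted_blowup R H) (u v : H) :
  density B u v = 1 - missing B u v.
Proof.
apply/eqP; rewrite -subr_eq opprK -big_split /= -(sum_cluster B u); apply/eqP.
apply: eq_bigr => x _.
rewrite -[RHS]mulr1 -(sum_cluster B v) big_distrr /=.
by rewrite [RHS](bigID (fun y => x -- y)).
Qed.

Lemma missing_sym (B : weighted_blowup R H) (u v : H) :
  missing B u v = missing B v u.
Proof.
rewrite /missing (exchange_big_dep (mem (cluster B v))) => [|x y _ /andP[]] //=.
apply: eq_bigr => y ->; apply: eq_big => x; rewrite ?(sedge_sym x) //.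
by rewrite mulrC.
Qed.

Lemma missing_ge0 (B : weighted_blowup R H) (u v : H) : 0 <= missing B u v.
Proof. by do 2!apply: sumr_ge0 => ? _; rewrite mulr_ge0 ?weight_ge0. Qed.

End MissingDensity.

(** * Ensuring densities are positive *)

Lemma edges_set2 (G : sgraph) (u v : G) : u -- v -> [set u; v] \in edges G.
Proof.
by move=> uv; rewrite inE; apply/existsP; exists u; apply/existsP; exists v;
  rewrite uv eqxx.
Qed.

Section CutEdge.
Variables (R : realType) (H : sgraph).

Definition cut_edge (e : {set H}) : rel H :=
  fun x y => (x -- y) && ([set x; y] != e).

Fact cut_edge_sym (e : {set H}) : symmetric (cut_edge e).
Proof. by move=> x y; rewrite /cut_edge sedge_sym setUC. Qed.

Fact cut_edge_irrefl (e : {set H}) : irreflexive (cut_edge e).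
Proof. by move=> x; rewrite /cut_edge sedge_irrefl. Qed.

Definition cut_graph (e : {set H}) : sgraph :=
  SGraph (cut_edge_sym e) (cut_edge_irrefl e).

Fact cut_proj_edge (e : {set H}) (x y : cut_graph e) :
  x -- y -> (x : H) -- (y : H).
Proof. by case/andP. Qed.

Fact cut_weight_cluster (v : H) : \sum_(x : H | x == v) 1 = 1 :> R.
Proof. by rewrite big_pred1_eq. Qed.

Definition cut_blowup (e : {set H}) : weighted_blowup R H :=
  @WeightedBlowup R H (cut_graph e) id (fun=> 1) (@cut_proj_edge e)
    (fun v => ex_intro _ v erefl) (fun=> ler01) cut_weight_cluster.

(** The blow-up of [H] by itself with [e] cut has density [1] on all edges but
[e], and its only candidate for a transversal is the identity, which fails on
[e]; so it refutes any densities that are at most [1] and not positive on [e]. *)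
Lemma ensures_factor_gt0 (gamma : {set H} -> R) :
  (forall e, e \in edges H -> gamma e <= 1) -> ensures_factor gamma ->
  forall e, e \in edges H -> 0 < gamma e.
Proof.
move=> gamma_le1 gammaF e He; rewrite ltNge; apply/negP => ge0.
have cl v x : (x \in cluster (cut_blowup e) v) = (x == v :> H) by rewrite inE.
case: (gammaF (cut_blowup e)) => [u v uv | phi [phiP phiE]].
  rewrite /density (big_pred1 u (cl u)).
  have [eE | neq] := eqVneq [set u; v] e.
    by rewrite eE (le_trans ge0) //; apply: sumr_ge0 => *; rewrite mulr1.
  rewrite (big_pred1 v) /= => [|y].
    by rewrite mulr1 gamma_le1 ?edges_set2.
  rewrite /= cl; have [->|//] := eqVneq y v.
  by rewrite /= /cut_edge uv neq.
have phi_id v : phi v = v by apply/eqP; rewrite -cl.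
move: (He); rewrite inE => /existsP[x /existsP[y /andP[xy /eqP eE]]].
by have := phiE _ _ xy; rewrite !phi_id /= /cut_edge eE eqxx andbF.
Qed.

End CutEdge.

(** * Induced subgraphs and vertices of a graph minus a vertex *)

Section Induced.
Variables (G : sgraph) (P : pred G).

Definition induced_edge : rel {x : G | P x} := fun x y => val x -- val y.

Fact induced_sym : symmetric induced_edge.
Proof. by move=> x y; apply: sedge_sym. Qed.

Fact induced_irrefl : irreflexive induced_edge.
Proof. by move=> x; apply: sedge_irrefl. Qed.

Definition induced : sgraph := SGraph induced_sym induced_irrefl.

End Induced.

Lemma sum_induced (V : nmodType) (G : sgraph) (P Q : pred G) (F : G -> V) :
  \sum_(x : induced P | Q (val x)) F (val x) = \sum_(x | P x && Q x) F x.
Proof. by rewrite -big_sub_cond. Qed.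

Lemma vertexP (G : sgraph) (l v : G) :
  v = l \/ exists v' : del_vertex l, v = val v'.
Proof.
have [->|vl] := eqVneq v l; first by left.
by right; exists (Sub v vl).
Qed.

(** * Pruning: from a blow-up of a graph to one of the graph minus a leaf *)

Section Leaf.
Variables (R : realType) (T : sgraph) (l p : T).
Hypothesis lE : forall u, l -- u = (u == p).
Local Notation T' := (del_vertex l).

Lemma pl_neq : p != l.
Proof. by apply/negP=> /eqP pl; have := lE p; rewrite eqxx pl sedge_irrefl. Qed.

(** The factor by which the weights over [v] change when only those over [p] are
rescaled; an edge [uv] then scales by the product of the factors of [u] and
[v], which treats edges at [p] and away from [p] alike. *)
Definition scale_at (a : R) (v : T) : R := if v == p then a else 1.

Lemma scale_at_gt0 a v : 0 < a -> 0 < scale_at a v.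
Proof. by rewrite /scale_at; case: ifP => // _ _; exact: ltr01. Qed.

(** At most one endpoint of an edge is [p], so the case distinction in the
reduced density is division by a product of two scaling factors. *)
Lemma reduced_densityE (r : {set T} -> R) (u v : T') : u -- v ->
  reduced_density p r [set u; v] =
  1 - r [set val u; val v] /
      (scale_at (1 - r [set p; l]) (val u) * scale_at (1 - r [set p; l]) (val v)).
Proof.
move=> uv; rewrite /reduced_density imsetU1 imset_set1 !inE /scale_at.
rewrite ![p == _]eq_sym.
have: val u != val v.
  by apply/eqP => E; move: uv; rewrite /= /del_edge E sedge_irrefl.
have [->|_] := eqVneq (val u) p => /=.
  by rewrite eq_sym => /negPf->; rewrite mulr1.
by have [->|_] := eqVneq (val v) p; rewrite ?mul1r ?invr1 ?mulr1.
Qed.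

Section Prune.
Variable B : weighted_blowup R T.

Definition served (x : B) : bool := [exists y in cluster B l, x -- y].

Definition kept (x : B) : bool :=
  (proj x != l) && ((proj x == p) ==> served x).

Definition served_weight : R := \sum_(x in cluster B p | served x) weight x.

Definition prune_graph : sgraph := induced kept.

Fact kept_proj (x : prune_graph) : proj (val x) != l.
Proof. by case/andP: (valP x). Qed.

Definition prune_proj (x : prune_graph) : T' := Sub (proj (val x)) (kept_proj x).

Definition prune_weight (x : prune_graph) : R :=
  weight (val x) / scale_at served_weight (proj (val x)).

(** Each vertex over [p] contributes to the density at most its own weight, and
nothing at all unless it has a neighbour over [l]. *)
Lemma density_le_served : density B p l <= served_weight.
Proof.
rewrite /density /served_weight [leRHS]big_mkcondr /=.
apply: ler_sum => x _; case: ifP => xs.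
  rewrite -big_distrr /= -[leRHS]mulr1 ler_wpM2l ?weight_ge0 //.
  rewrite -(sum_cluster B l) [leRHS](bigID (fun y => x -- y)) /= lerDl.
  by apply: sumr_ge0 => *; apply: weight_ge0.
rewrite big_pred0 // => y; apply/negbTE/negP => yx.
by case/andP: yx => yl xy; case/negP: (negbT xs); apply/exists_inP; exists y.
Qed.

Hypothesis W_gt0 : 0 < served_weight.

Fact prune_proj_edge (x y : prune_graph) : x -- y -> prune_proj x -- prune_proj y.
Proof. exact: proj_edge. Qed.

Fact prune_weight_ge0 (x : prune_graph) : 0 <= prune_weight x.
Proof. by rewrite divr_ge0 ?weight_ge0 ?ltW ?scale_at_gt0. Qed.

Fact prune_weight_cluster (v : T') : \sum_(x | prune_proj x == v) prune_weight x = 1.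
Proof.
rewrite (@sum_induced _ B kept (fun x => proj x == val v)
  (fun x => weight x / scale_at served_weight (proj x))) /=.
have [vp|vp] := eqVneq (val v) p.
  transitivity (\sum_(x in cluster B p | served x) weight x / served_weight).
    apply: eq_big => x; rewrite /kept ?inE /scale_at vp.
      by have [->|_] := eqVneq (proj x) p; rewrite ?andbF // pl_neq andbT.
    by case/andP=> _ ->.
  by rewrite -mulr_suml divff ?gt_eqF.
rewrite -[RHS](weight_cluster B (val v)); apply: eq_big => x; rewrite /kept /scale_at.
  by have [->|_] := eqVneq (proj x) (val v); rewrite ?andbF // (negPf vp) (valP v).
by case/andP=> _ /eqP->; rewrite (negPf vp) divr1.
Qed.

(** The kept cluster of [p] is nonempty because its weight is positive. *)
Fact prune_proj_surj (v : T') : exists x, prune_proj x = v.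
Proof.
have [x /eqP xv | nx] := pickP (fun x => prune_proj x == v); first by exists x.
by have /eqP := prune_weight_cluster v; rewrite big_pred0 // eq_sym oner_eq0.
Qed.

Definition prune : weighted_blowup R T' :=
  WeightedBlowup prune_proj_edge prune_proj_surj prune_weight_ge0
    prune_weight_cluster.

(** This is where the missing density is easier than the density: it is a sum of
nonnegative terms over pairs, some of which disappear, so pruning can only
decrease it before the rescaling. *)
Lemma missing_prune (u v : T') :
  missing prune u v <= missing B (val u) (val v) /
    (scale_at served_weight (val u) * scale_at served_weight (val v)).
Proof.
have sub (Q : pred B) (F : B -> R) : (forall x, 0 <= F x) ->
    \sum_(x : prune_graph | Q (val x)) F (val x) <= \sum_(x | Q x) F x.
  move=> F0; rewrite (sum_induced kept Q F) [leRHS](bigID kept) /=.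
  rewrite (eq_bigl _ _ (fun x => andbC (kept x) _)).
  by rewrite lerDl sumr_ge0.
set c := scale_at _ _ * scale_at _ _.
have c_ge0 : 0 <= c by rewrite mulr_ge0 ?ltW ?scale_at_gt0.
pose wt x y : R := weight (x : B) * weight (y : B) / c.
have wt_ge0 x y : 0 <= wt x y by rewrite divr_ge0 ?c_ge0 ?mulr_ge0 ?weight_ge0.
pose F x := \sum_(y in cluster B (val v) | ~~ (x -- y)) wt x y.
have F_ge0 x : 0 <= F x by apply: sumr_ge0.
have -> : missing B (val u) (val v) / c = \sum_(x in cluster B (val u)) F x.
  by rewrite mulr_suml; apply: eq_bigr => x _; rewrite mulr_suml.
apply: le_trans (sub (mem (cluster B (val u))) F F_ge0).
rewrite /missing (eq_bigl (fun x : prune_graph => val x \in cluster B (val u))).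
  apply: ler_sum => x; rewrite inE => /eqP xu.
  apply: le_trans (sub (fun y => (y \in cluster B (val v)) && ~~ (val x -- y))
    (wt (val x)) (wt_ge0 _)).
  rewrite le_eqVlt; apply/orP; left; apply/eqP; apply: eq_big => y.
    by rewrite !inE.
  rewrite inE => /andP[/eqP yv _]; rewrite /= /prune_weight /wt.
  have [-> ->] : proj (val x) = val u /\ proj (val y) = val v by rewrite -xu -yv.
  by rewrite mulrACA -invfM.
by move=> x; rewrite !inE.
Qed.

(** The vertex chosen over [p] was kept because it has a neighbour over [l], and
that neighbour completes the transversal, [p] being the only neighbour of [l]. *)
Lemma prune_transversal : has_transversal prune -> has_transversal B.
Proof.
case=> phi [phiP phiE].
have projE v : proj (val (phi v)) = val v.
  by have := phiP v; rewrite inE => /eqP {2}<-.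
pose p' : T' := Sub p pl_neq.
have /exists_inP[z zl pz] : served (val (phi p')).
  by case/andP: (valP (phi p')); rewrite projE eqxx.
pose psi v := if insub v is Some v' then val (phi v') else z.
have psi_val (v : T') : psi (val v) = val (phi v) by rewrite /psi valK.
have psi_l : psi l = z by rewrite /psi insubF ?eqxx.
exists psi; split=> [v | u v].
  case: (vertexP l v) => [->|[v' ->]]; first by rewrite psi_l.
  by rewrite psi_val inE projE.
case: (vertexP l u) => [->|[u' ->]]; case: (vertexP l v) => [->|[v' ->]].
- by rewrite sedge_irrefl.
- by rewrite lE psi_l => /eqP E; rewrite E sedge_sym -[p]/(val p') psi_val.
- rewrite sedge_sym lE psi_l => /eqP E.
  by rewrite E -[p]/(val p') psi_val.
- by rewrite !psi_val => /(phiE u' v').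
Qed.

End Prune.

(** * Extending: from a blow-up of the graph minus a leaf to one of the graph *)

Section Extend.
Variables (B : weighted_blowup R T') (a : R).
Hypotheses (a_ge0 : 0 <= a) (a_le1 : a <= 1).

(** [None] is the single vertex over the leaf, [Some None] the decoy over [p], and
[Some (Some z)] an old vertex. *)
Definition extend_edge : rel (option (option B)) := fun x y =>
  match x, y with
  | Some (Some x), Some (Some y) => x -- y
  | Some (Some z), Some None | Some None, Some (Some z) => p -- val (proj z)
  | Some (Some z), None | None, Some (Some z) => val (proj z) == p
  | _, _ => false
  end.

Fact extend_sym : symmetric extend_edge.
Proof. by move=> [[x|]|] [[y|]|] //=; apply: sedge_sym. Qed.

Fact extend_irrefl : irreflexive extend_edge.
Proof. by move=> [[x|]|] //=; apply: sedge_irrefl. Qed.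

Definition extend_graph : sgraph := SGraph extend_sym extend_irrefl.

Definition extend_proj (x : extend_graph) : T :=
  match x with
  | Some (Some z) => val (proj z)
  | Some None => p
  | None => l
  end.

Definition extend_weight (x : extend_graph) : R :=
  match x with
  | Some (Some z) => scale_at a (val (proj z)) * weight z
  | Some None => 1 - a
  | None => 1
  end.

Fact extend_proj_edge (x y : extend_graph) :
  x -- y -> extend_proj x -- extend_proj y.
Proof.
case: x y => [[x|]|] [[y|]|] //=; last by rewrite lE.
- exact: proj_edge.
- by rewrite sedge_sym.
- by rewrite sedge_sym lE.
Qed.

Fact extend_weight_ge0 (x : extend_graph) : 0 <= extend_weight x.
Proof.
case: x => [[x|]|] //=; rewrite ?subr_ge0 // mulr_ge0 ?weight_ge0 //.
by rewrite /scale_at; case: ifP.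
Qed.

Fact extend_weight_cluster (v : T) :
  \sum_(x | extend_proj x == v) extend_weight x = 1.
Proof.
rewrite !sum_option /=; have [<-|vl] := eqVneq l v.
  rewrite (negPf pl_neq) big_pred0 ?addr0 // => z.
  exact/negbTE/(valP (proj z)).
have vl' : v != l by rewrite eq_sym.
transitivity ((if p == v then 1 - a else 0) +
    \sum_(z : B | proj z == Sub v vl' :> T') scale_at a v * weight z).
  by rewrite add0r; congr (_ + _); apply: eq_bigr => z /eqP->.
rewrite -mulr_sumr weight_cluster mulr1 /scale_at eq_sym.
by case: eqP; rewrite ?subrK ?add0r.
Qed.

Fact extend_proj_surj (v : T) : exists x, extend_proj x = v.
Proof.
have [->|vl] := eqVneq v l; first by exists None.
by have [x xv] := proj_surj B (Sub v vl : T'); exists (Some (Some x)); rewrite /= xv.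
Qed.

Definition extend : weighted_blowup R T :=
  WeightedBlowup extend_proj_edge extend_proj_surj extend_weight_ge0
    extend_weight_cluster.

(** Seen from the other clusters, the decoy is completely joined and so misses
nothing; only the rescaling of the old vertices over [p] is felt. *)
Lemma missing_extend (u v : T') : u -- v ->
  missing extend (val u) (val v) =
  scale_at a (val u) * scale_at a (val v) * missing B u v.
Proof.
move=> uv.
have uv' : val u -- val v by [].
have inC (w : T') (z : B) :
    ((Some (Some z) : extend_graph) \in cluster extend (val w)) =
    (z \in cluster B w).
  by rewrite !inE.
have inl (w : T') : ((None : extend_graph) \in cluster extend (val w)) = false.
  by rewrite inE /= eq_sym; apply/negbTE/(valP w).
rewrite /missing sum_option inl add0r sum_option.
rewrite [X in _ + X = _](eq_bigl _ _ (inC u)).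
(* The decoy is adjacent to the whole cluster of [v] if it lies over [u]. *)
rewrite (_ : (if _ then _ else _) = 0) ?add0r; last first.
  rewrite inE /=; case: eqP => // pu; rewrite big_pred0 // => y.
  rewrite inE; apply/negP; case: y => [[y|]|] /= /andP[/eqP yv].
  - by rewrite yv pu uv'.
  - by move: uv'; rewrite -[val u]pu -[val v]yv sedge_irrefl.
  - by move: (valP v); rewrite /= -yv eqxx.
rewrite mulr_sumr; apply: eq_bigr => x; rewrite inE => /eqP xu.
(* Likewise an old vertex over [u] is adjacent to the decoy if that is over [v]. *)
rewrite mulr_sumr !sum_option inl add0r ifF ?add0r; last first.
  rewrite inE /= xu; apply/negP => /andP[/eqP pv]; rewrite pv sedge_sym.
  by rewrite uv'.
apply: eq_big => [y|y /andP[]]; first by rewrite inC.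
by rewrite inC inE => /eqP yv _ /=; rewrite xu yv mulrACA.
Qed.

Lemma missing_extend_leaf : missing extend l p = 1 - a.
Proof.
rewrite /missing (big_pred1 (None : extend_graph)) => [|[[z|]|]].
- rewrite (big_pred1 (Some None : extend_graph)) => [|[[z|]|]] /=.
  + by rewrite mul1r.
  + by rewrite inE /= andbN.
  + by rewrite inE /= eqxx.
  + by rewrite inE /= eq_sym (negPf pl_neq).
- by rewrite inE /=; apply/negbTE/(valP (proj z)).
- by rewrite inE /= (negPf pl_neq).
- by rewrite inE /= eqxx.
Qed.

(** The image of [p] must be adjacent to the single vertex over [l], so it is not
the decoy, and all other images are old vertices. *)
Lemma extend_transversal : has_transversal extend -> has_transversal B.
Proof.
case=> phi [phiP phiE].
have projE v : extend_proj (phi v) = v by apply/eqP; have := phiP v; rewrite inE.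
have phi_l : phi l = None.
  case: (phi l) (projE l) => [[z|]|] //= E.
    by have := valP (proj z); rewrite /= E eqxx.
  by case/negP: pl_neq; rewrite E.
have pick (v : T') : {z : B | phi (val v) = Some (Some z) & proj z = v}.
  case: (phi (val v)) (projE (val v)) (phiE (val v) l) => [[z|]|] /= E.
  - by move=> _; exists z => //; apply: val_inj.
  - by rewrite -[val v]E sedge_sym lE eqxx phi_l => /(_ isT).
  - by have := valP v; rewrite /= -E eqxx.
exists (fun v => s2val (pick v)); split=> [v | u v uv].
  by case: (pick v) => z /= _ zv; rewrite inE zv.
case: (pick u) (pick v) => x xE _ [y yE _] /=.
by have := phiE (val u) (val v) uv; rewrite xE yE.
Qed.

End Extend.
End Leaf.

(** * The leaf reduction *)

Lemma leaf_edge (T : sgraph) (l p : T) :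
  is_leaf l -> l -- p -> forall u, l -- u = (u == p).
Proof.
move=> /cards1P[q lq] lp u.
have qE x : l -- x = (x == q) by rewrite -in_set1 -lq inE.
by move: lp; rewrite !qE => /eqP->.
Qed.

Section Reduction.
Variables (R : realType) (T : sgraph) (l p : T) (r : {set T} -> R).
Hypothesis lE : forall u, l -- u = (u == p).
Hypothesis r_ge0 : forall e, e \in edges T -> 0 <= r e.
Hypothesis r_lt1 : r [set p; l] < 1.

Local Notation a := (1 - r [set p; l]).
Local Notation reduced := (reduced_density (l := l) p r).

Let a_gt0 : 0 < a. Proof. by rewrite subr_gt0. Qed.

Let scale_gt0 v : 0 < scale_at p a v. Proof. exact: scale_at_gt0. Qed.

Let pl_edge : p -- l. Proof. by rewrite sedge_sym lE. Qed.

Let density_condE (B : weighted_blowup R T) (u v : T) :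
  (1 - r [set u; v] <= density B u v) = (missing B u v <= r [set u; v]).
Proof. by rewrite densityE lerD2l lerN2. Qed.

Let reduced_condE (B : weighted_blowup R (del_vertex l)) (u v : del_vertex l) :
  u -- v ->
  (reduced [set u; v] <= density B u v) =
  (missing B u v <=
     r [set val u; val v] / (scale_at p a (val u) * scale_at p a (val v))).
Proof. by move=> uv; rewrite reduced_densityE // densityE lerD2l lerN2. Qed.

Lemma reduced_le1 e : e \in edges (del_vertex l) -> reduced e <= 1.
Proof.
rewrite inE => /existsP[u /existsP[v /andP[uv /eqP->]]].
rewrite reduced_densityE // lerBlDr lerDl.
by rewrite divr_ge0 ?r_ge0 ?edges_set2 // mulr_ge0 ?ltW.
Qed.

Lemma ensures_reduced : ensures_factor (fun e => 1 - r e) -> ensures_factor reduced.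
Proof.
move=> rF B Bdens.
have a_le1 : a <= 1 by rewrite lerBlDr lerDl r_ge0 // edges_set2.
apply: (@extend_transversal R T l p lE B a (ltW a_gt0) a_le1).
apply: rF => u v; rewrite density_condE.
case: (vertexP l u) => [->|[u' ->]]; case: (vertexP l v) => [->|[v' ->]].
- by rewrite sedge_irrefl.
- by rewrite lE => /eqP->; rewrite missing_extend_leaf setUC subKr.
- by rewrite sedge_sym lE => /eqP->; rewrite missing_sym missing_extend_leaf subKr.
- move=> uv; rewrite missing_extend // mulrC -ler_pdivlMr ?mulr_gt0 //.
  by rewrite -reduced_condE // Bdens.
Qed.

Lemma ensures_of_reduced :
  ensures_factor reduced -> ensures_factor (fun e => 1 - r e).
Proof.
move=> redF B Bdens.
have aW := le_trans (Bdens p l pl_edge) (density_le_served l p B).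
have W_gt0 := lt_le_trans a_gt0 aW.
apply: (@prune_transversal _ _ _ _ lE _ W_gt0).
apply: redF => u v uv; rewrite reduced_condE //.
apply: le_trans (missing_prune lE W_gt0 u v) _.
have scaleS x : scale_at p a x <= scale_at p (served_weight l p B) x.
  by rewrite /scale_at; case: ifP.
have scale_ge0 x : 0 <= scale_at p a x by rewrite ltW.
rewrite ler_pM ?missing_ge0 ?invr_ge0 -?density_condE ?Bdens //.
  by rewrite mulr_ge0 ?(le_trans (scale_ge0 _) (scaleS _)).
rewrite lef_pV2 ?posrE ?mulr_gt0 ?ler_pM //.
all: exact: lt_le_trans (scale_gt0 _) (scaleS _).
Qed.

End Reduction.

Lemma eq_ensures_factor (R : realType) (H : sgraph) (f g : {set H} -> R) :
  (forall e, e \in edges H -> f e = g e) -> ensures_factor f -> ensures_factor g.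
Proof.
move=> fg fF B Bdens; apply: fF => u v uv.
by rewrite fg ?edges_set2 // Bdens.
Qed.

Theorem theorem3p1 (R : realType) (T : sgraph) (vn vn1 : T)
    (gamma r : {set T} -> R)
    (T_tree : is_tree T)
    (T_size : (2 <= #|T|)%N)
    (vn_leaf : is_leaf vn)
    (vn1_neighbour : vn -- vn1)
    (gammaE : forall e, e \in edges T -> gamma e = 1 - r e)
    (gamma_01 : forall e, e \in edges T -> 0 <= gamma e <= 1)
    (r_lt1 : r [set vn1; vn] < 1) :
  ensures_factor gamma <->
  (forall e, e \in edges (del_vertex vn) ->
     0 <= reduced_density vn1 r e <= 1) /\
  ensures_factor (reduced_density (l := vn) vn1 r).
Proof.
have lE := leaf_edge vn_leaf vn1_neighbour.
have r_ge0 e : e \in edges T -> 0 <= r e.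
  by move=> eT; have := gamma_01 e eT; rewrite gammaE // lerBlDr lerDl => /andP[].
split=> [gammaF | [_ /(ensures_of_reduced lE r_lt1)]].
  have redF : ensures_factor (reduced_density (l := vn) vn1 r).
    exact: (ensures_reduced lE r_ge0 r_lt1 (eq_ensures_factor gammaE gammaF)).
  have red_le1 := reduced_le1 r_ge0 r_lt1.
  split=> // e eT'; rewrite red_le1 // andbT ltW //.
  exact: (ensures_factor_gt0 red_le1).
by apply: eq_ensures_factor => e eT; rewrite gammaE.
Qed.
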